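(* Let $R$ be a commutative ring with unity and let $x,y\in R$. Then $x\,\mathcal{J}\,y$ if and only if $y+(0)\in xU_{\overline{x}}$. Consequently the sets $xU_{\overline{x}}$ ($x\in R$) are the $\mathcal{J}$-classes of the multiplicative semigroup of $R/(0)$.
   Context: $\mathcal{J}$ is Green's relation on the multiplicative semigroup of $R$: $x\,\mathcal{J}\,y$ iff $x$ and $y$ generate the same principal ideal of that semigroup (as $R$ is commutative with $1$, iff $xR=yR$). For $x\in R$, $\overline{x}=\mathrm{Ann}(x)=\{y\in R : xy=0\}$, $R_{\overline{x}}=R/\overline{x}$, $U_{\overline{x}}$ is the group of units of $R_{\overline{x}}$, and $[u]_{\overline{x}}=u+\overline{x}$. One sets $x[u]_{\overline{x}} = \{xw : w\in u+\overline{x}\}=xu+(0)\in R/(0)$ (well defined since $x\overline{x}=(0)$), and $xU_{\overline{x}}=\{x[u]_{\overline{x}} : [u]_{\overline{x}}\in U_{\overline{x}}\}\subseteq R/(0)$. $R/(0)$ is identified with $R$ naturally via $x\mapsto x+(0)$. *)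

(* Defs.v *)
From HB Require Import structures.
From mathcomp Require Import all_boot all_algebra.
From mathcomp Require Import boolp classical_sets.

Set Implicit Arguments.
Unset Strict Implicit.
Unset Printing Implicit Defensive.

Import GRing.Theory.
Local Open Scope ring_scope.
Local Open Scope quotient_scope.
Local Open Scope classical_set_scope.

(* MathComp's [idealr] and the ring structure on [{ideal_quot I}] require I to
   be proper and the ring to be nonzero.  The annihilator of 0 is the whole
   ring, so the improper ideal and the zero ring are needed here. *)
HB.mixin Record isMulAbsorbing (R : comPzRingType) (S : R -> bool) := {
  mul_absorbing_subproof : forall a, {in S, forall u, a * u \in S}
}.

#[short(type="ideal")]
HB.structure Definition Ideal (R : comPzRingType) :=
  {S of GRing.ZmodClosed R S & isMulAbsorbing R S}.

Section QuotientRing.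
Variables (R : comPzRingType) (I : ideal R).

Definition quot_ring : Type := Quotient.quot I.

HB.instance Definition _ := GRing.Zmodule.on quot_ring.
HB.instance Definition _ := EqQuotient.on quot_ring.

Definition quot_one : quot_ring := \pi_quot_ring 1.
Definition quot_mul : quot_ring -> quot_ring -> quot_ring :=
  lift_op2 quot_ring *%R.

Lemma quot_eqP (u v : R) :
  reflect (\pi_quot_ring u = \pi_quot_ring v) (u - v \in I).
Proof. by apply: (iffP idP) => [|/eqP]; rewrite Quotient.idealrBE => // /eqP. Qed.

Lemma pi_quot_mul (u v : R) :
  quot_mul (\pi_quot_ring u) (\pi_quot_ring v) = \pi_quot_ring (u * v).
Proof.
unlock quot_mul; apply/quot_eqP; set u' := repr _; set v' := repr _.
have hu : u' - u \in I by apply/quot_eqP; rewrite reprK.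
have hv : v' - v \in I by apply/quot_eqP; rewrite reprK.
have -> : u' * v' - u * v = v' * (u' - u) + u * (v' - v).
  by rewrite !mulrBr (mulrC v' u') (mulrC v' u) addrA addrNK.
by rewrite rpredD // mul_absorbing_subproof.
Qed.

Lemma pi_quot_add (u v : R) :
  \pi_quot_ring u + \pi_quot_ring v = \pi_quot_ring (u + v).
Proof. exact: esym (Quotient.pi_add I u v). Qed.

Lemma quot_mulA : associative quot_mul.
Proof.
move=> a b c; rewrite -(reprK a) -(reprK b) -(reprK c).
by rewrite !pi_quot_mul mulrA.
Qed.

Lemma quot_mulC : commutative quot_mul.
Proof. by move=> a b; unlock quot_mul; rewrite mulrC. Qed.

Lemma quot_mul1 : left_id quot_one quot_mul.
Proof. by move=> a; rewrite -(reprK a) pi_quot_mul mul1r. Qed.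

Lemma quot_mulD : left_distributive quot_mul +%R.
Proof.
move=> a b c; rewrite -(reprK a) -(reprK b) -(reprK c).
by rewrite pi_quot_add !pi_quot_mul pi_quot_add mulrDl.
Qed.

HB.instance Definition _ := GRing.Zmodule_isComPzRing.Build quot_ring
  quot_mulA quot_mulC quot_mul1 quot_mulD.

End QuotientRing.

Definition zero_ideal (R : comPzRingType) : {pred R} := fun y => y == 0.

Section ZeroIdeal.
Variable R : comPzRingType.

Lemma zero_ideal_zmod_closed : zmod_closed (@zero_ideal R).
Proof.
by split=> [|u v]; rewrite !unfold_in /zero_ideal // => /eqP-> /eqP->; rewrite subrr.
Qed.

Lemma zero_ideal_absorbing a :
  {in @zero_ideal R, forall u, a * u \in @zero_ideal R}.
Proof. by move=> u; rewrite !unfold_in /zero_ideal => /eqP->; rewrite mulr0. Qed.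

HB.instance Definition _ := GRing.isZmodClosed.Build R (@zero_ideal R)
  zero_ideal_zmod_closed.
HB.instance Definition _ := isMulAbsorbing.Build R (@zero_ideal R)
  zero_ideal_absorbing.
End ZeroIdeal.

Definition ann (R : comPzRingType) (x : R) : {pred R} := fun y => x * y == 0.

Section Annihilator.
Variables (R : comPzRingType) (x : R).

Lemma ann_zmod_closed : zmod_closed (ann x).
Proof.
split=> [|u v]; rewrite !unfold_in /ann ?mulr0 // => /eqP hu /eqP hv.
by rewrite mulrBr hu hv subrr.
Qed.

Lemma ann_absorbing a : {in ann x, forall u, a * u \in ann x}.
Proof.
by move=> u; rewrite !unfold_in /ann => /eqP hu; rewrite mulrCA hu mulr0.
Qed.

HB.instance Definition _ := GRing.isZmodClosed.Build R (ann x) ann_zmod_closed.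
HB.instance Definition _ := isMulAbsorbing.Build R (ann x) ann_absorbing.
End Annihilator.

Notation quot_zero R := (quot_ring (@zero_ideal R)).
Notation quot_ann x := (quot_ring (ann x)).

(* [GRing.unit] is not available on a [comPzRingType]. *)
Definition units (A : comPzRingType) : set A :=
  [set u | exists v, u * v = 1].

(* The map [u] |-> x[u], from R/Ann(x) to R/(0).  It does not depend on the
   representative (ann_smul_pi), and its value is, as a coset of (0), the set
   {x w : w in [u]} (ann_smul_coset). *)
Definition ann_smul (R : comPzRingType) (x : R) (c : quot_ann x) : quot_zero R :=
  \pi_(quot_zero R) (x * repr c).

Lemma ann_smul_pi (R : comPzRingType) (x u : R) :
  ann_smul (\pi_(quot_ann x) u) = \pi_(quot_zero R) (x * u).
Proof.
apply/quot_eqP; rewrite -mulrBr.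
suff : repr (\pi_(quot_ann x) u) - u \in ann x by [].
by apply/quot_eqP; rewrite reprK.
Qed.

Lemma ann_smul_coset (R : comPzRingType) (x : R) (c : quot_ann x) :
  [set x * w | w in [set w | \pi_(quot_ann x) w = c]] =
  [set z | \pi_(quot_zero R) z = ann_smul c].
Proof.
apply/seteqP; split=> [_ [w <- <-]|z /=]; first by rewrite /= ann_smul_pi.
move=> /quot_eqP; rewrite unfold_in /zero_ideal /= subr_eq0 => /eqP->.
by exists (repr c) => //=; rewrite reprK.
Qed.

Definition xU (R : comPzRingType) (x : R) : set (quot_zero R) :=
  [set ann_smul c | c in @units (quot_ann x)].

(* Ideals of the multiplicative semigroup of A, not ring ideals. *)
Definition mul_ideal (A : pzRingType) (S : set A) : Prop :=
  forall a s, S a -> S (s * a) /\ S (a * s).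

Definition principal_mul_ideal (A : pzRingType) (x : A) : set A :=
  smallest (@mul_ideal A) [set x].

Definition green_J (A : pzRingType) (x y : A) : Prop :=
  principal_mul_ideal x = principal_mul_ideal y.

Definition J_class (A : pzRingType) (x : A) : set A := [set y | green_J x y].

(* Main.v *)
(** If [y = x a] and [x = y b] then [x (a b - 1) = 0], so [a] is a unit modulo
    [Ann x]; conversely a unit [u] modulo [Ann x] with inverse [v] satisfies
    [x u v = x], so [x u] and [x] divide each other. *)
Require Import Defs.
From mathcomp Require Import all_boot all_algebra.
From mathcomp Require Import classical_sets.

Import GRing.Theory.
Local Open Scope ring_scope.
Local Open Scope quotient_scope.
Local Open Scope classical_set_scope.

(** By commutativity the multiples of [x] absorb products on both sides, and [1] puts [x] among
    them; any ideal containing [x] absorbs [x * a]. *)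
Lemma principal_mul_idealE (A : comPzRingType) (x : A) :
  principal_mul_ideal x = [set x * a | a in [set: A]].
Proof.
apply/seteqP; split=> [y|_ [a _ <-] S [idS xS]].
  apply; split=> [_ a [b _ <-]|_ ->]; last by exists 1; rewrite ?mulr1.
  by rewrite [a * _]mulrC; split; exists (b * a); rewrite // mulrA.
by have [] := idS x a (xS x erefl).
Qed.

Lemma green_JP (A : comPzRingType) (x y : A) :
  green_J x y <-> (exists a, y = x * a) /\ (exists b, x = y * b).
Proof.
rewrite /green_J !principal_mul_idealE; split=> [eqxy|[[a ya] [b xb]]].
  split.
    have [a _ <-] : [set x * a | a in [set: A]] y.
      by rewrite eqxy; exists 1; rewrite ?mulr1.
    by exists a.
  have [b _ <-] : [set y * a | a in [set: A]] x.
    by rewrite -eqxy; exists 1; rewrite ?mulr1.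
  by exists b.
apply/seteqP; split=> _ [c _ <-].
  by exists (b * c); rewrite // mulrA -xb.
by exists (a * c); rewrite // mulrA -ya.
Qed.

(** Recasts [pi_quot_mul] with the ring product [*] in place of [quot_mul], for rewriting. *)
Lemma pi_quotM (R : comPzRingType) (I : ideal R) (u v : R) :
  \pi_(quot_ring I) u * \pi_(quot_ring I) v = \pi_(quot_ring I) (u * v).
Proof. exact: pi_quot_mul. Qed.

Lemma pi_quot_zero_inj (R : comPzRingType) :
  injective (\pi_(quot_zero R) : R -> quot_zero R).
Proof.
by move=> u v /quot_eqP; rewrite unfold_in /zero_ideal subr_eq0 => /eqP.
Qed.

Lemma pi_quot_annP (R : comPzRingType) (x u v : R) :
  \pi_(quot_ann x) u = \pi_(quot_ann x) v <-> x * u = x * v.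
Proof.
split=> [/quot_eqP|xuv]; last apply/quot_eqP; rewrite unfold_in /ann mulrBr.
  by rewrite subr_eq0 => /eqP.
by rewrite xuv subrr.
Qed.

(** Multiplying by [x] turns the congruence [u * v = 1] modulo [Ann x] into an equation in [R]. *)
Lemma units_quot_annP (R : comPzRingType) (x u : R) :
  @units (quot_ann x) (\pi_(quot_ann x) u) <-> exists v, x * u * v = x.
Proof.
split=> [[c]|[v xuv]].
  rewrite -(reprK c) pi_quotM => /pi_quot_annP.
  by rewrite mulr1 mulrA => xuv; exists (repr c).
exists (\pi_(quot_ann x) v); rewrite pi_quotM; apply/pi_quot_annP.
by rewrite mulr1 mulrA.
Qed.

Lemma green_J_xU (R : comPzRingType) (x y : R) :
  green_J x y <-> xU x (\pi_(quot_zero R) y).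
Proof.
split=> [/green_JP[[a ya] [b xb]]|[c]].
  exists (\pi_(quot_ann x) a); last by rewrite ann_smul_pi ya.
  by apply/units_quot_annP; exists b; rewrite -ya -xb.
rewrite -(reprK c) => /units_quot_annP[v xcv].
(* Equality of cosets of [(0)] gives [y = x * repr c] in [R] itself. *)
rewrite ann_smul_pi => /pi_quot_zero_inj <-.
by apply/green_JP; split; [exists (repr c)|exists v].
Qed.

(** The projection onto [R/(0)] is multiplicative and bijective, so divisibility transfers both
    ways. This links the relation on [R] to the classes of [R/(0)]. *)
Lemma green_J_pi_quot_zero (R : comPzRingType) (x y : R) :
  green_J (\pi_(quot_zero R) x) (\pi_(quot_zero R) y) <-> green_J x y.
Proof.
split=> /green_JP[[a ya] [b xb]]; apply/green_JP; split.
- exists (repr a); apply: pi_quot_zero_inj.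
  by rewrite -pi_quotM reprK.
- exists (repr b); apply: pi_quot_zero_inj.
  by rewrite -pi_quotM reprK.
- by exists (\pi_(quot_zero R) a); rewrite pi_quotM -ya.
- by exists (\pi_(quot_zero R) b); rewrite pi_quotM -xb.
Qed.

Lemma xU_J_class (R : comPzRingType) (x : R) :
  xU x = J_class (\pi_(quot_zero R) x).
Proof.
apply/seteqP; split=> z; rewrite -(reprK z).
  by move=> /green_J_xU /green_J_pi_quot_zero.
by move=> /green_J_pi_quot_zero /green_J_xU.
Qed.

Theorem theorem2p3 (R : comPzRingType) :
  (forall x y : R, green_J x y <-> xU x (\pi_(quot_zero R) y)) /\
  [set xU x | x in [set: R]] = [set J_class a | a in [set: quot_zero R]].
Proof.
split; first exact: green_J_xU.
apply/seteqP; split=> _ [x _ <-].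
  by exists (\pi_(quot_zero R) x); rewrite ?xU_J_class.
(* Here [x] lies in [R/(0)], so its class is indexed by a representative in [R]. *)
by exists (repr x); rewrite // xU_J_class reprK.
Qed.
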